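(* Let $M$ be a tracial von Neumann algebra with property (Gamma). Then $M$ is not properly proximal.
   Context: A tracial von Neumann algebra $(M,\tau)$ is a von Neumann algebra with a faithful normal tracial state. $M$ has property (Gamma) if there is a net (a sequence, when $M$ is separable) of unitaries $u_n\in\mathcal U(M)$ with $u_n\to 0$ ultraweakly and $\|[x,u_n]\|_2\to 0$ for all $x\in M$. Let $M\subset L^2M\subset L^1M$ be the natural inclusions, $J\hat x=\widehat{x^*}$ the conjugation on $L^2M$. For $T\in\mathbb B(L^2M)$ put $\|T\|_{\infty,1}=\sup\{\|T\hat x\|_1: x\in M,\|x\|\le1\}$. Let $\mathbb K^{\infty,1}(M)$ be the $\|\cdot\|_{\infty,1}$-closure of $\mathbb K(L^2M)$ in $\mathbb B(L^2M)$ and $\mathbb S(M)=\{T\in\mathbb B(L^2M)\mid [T,JxJ]\in\mathbb K^{\infty,1}(M)\ \forall x\in M\}$, an operator system containing $M$ and an $M$-bimodule. $M$ is properly proximal if there is no state $\varphi$ on $\mathbb S(M)$ which is $M$-central ($\varphi(xT)=\varphi(Tx)$ for all $x\in M$, $T \in \mathbb S(M)$) and such that $\varphi_{|M}$ is normal. *)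

(* Defs.v *)
From HB Require Import structures.
From mathcomp Require Import all_boot all_order all_algebra.
From mathcomp Require Import all_classical all_reals.
From mathcomp Require Import topology normedtype sequences.
From mathcomp Require Import complex.

Set Implicit Arguments.
Unset Strict Implicit.
Unset Printing Implicit Defensive.

Import Order.TTheory GRing.Theory Num.Theory.
Import numFieldNormedType.Exports.

Local Open Scope classical_set_scope.
Local Open Scope ring_scope.
Local Open Scope complex_scope.

(* The inner product is linear in its first argument. The scalar field [R[i]]
   carries no canonical topology of its own; it is given the one of the normed
   module [R[i]^o]. *)
HB.mixin Record CompleteNormedModule_isHilbert (R : realType) H
    & CompleteNormedModule R[i] H := {
  dotp : {dot H for (@Num.conj R[i])} ;
  dotp_norm : forall v : H, dotp v v = `|v| ^+ 2
}.

#[short(type="hilbertType")]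
HB.structure Definition Hilbert (R : realType) :=
  {H of CompleteNormedModule R[i] H & CompleteNormedModule_isHilbert R H}.

(* Norms of complex normed modules are valued in [R[i]]. *)
Definition rnorm (R : realType) (V : normedModType R[i]) (v : V) : R :=
  complex.Re `|v|.

Section Operators.
Context {R : realType} {H : hilbertType R}.
Implicit Types (S T : H -> H) (A M : set (H -> H)) (f : (H -> H) -> R[i]).

Definition bounded_op : set (H -> H) := [set T | linear T /\ continuous T].

Definition op_norm T : R := sup [set rnorm (T v) | v in [set v | rnorm v <= 1]].

Definition is_adjoint T S := forall u v, dotp (T u) v = dotp u (S v).

(* The default value is irrelevant: a bounded operator has a unique adjoint. *)
Definition adj T : H -> H := xget 0 [set S | is_adjoint T S].

Definition commutator S T : H -> H := (S \o T) - (T \o S).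

Definition positive_op T := forall v, 0 <= dotp (T v) v.

Definition is_absolute_value T S :=
  [/\ bounded_op S, positive_op S & S \o S = adj T \o T].

Definition compact_op : set (H -> H) := [set T | bounded_op T /\
  compact (closure (T @` [set v | rnorm v <= 1]))].

Definition commutant A : set (H -> H) :=
  [set T | bounded_op T /\ forall S, A S -> T \o S = S \o T].

(* A bicommutant is automatically a unital subalgebra. *)
Definition von_neumann_algebra M :=
  [/\ M `<=` bounded_op, forall T, M T -> M (adj T)
    & commutant (commutant M) = M].

Definition square_summable (xi : nat -> H) :=
  cvgn (series (fun k => rnorm (xi k) ^+ 2)).

Definition uw_pairing (xi eta : nat -> H) T : R[i]^o :=
  limn (series (fun k => dotp (T (xi k)) (eta k) : R[i]^o)).

Definition ultraweak_cvg (F : set_system (H -> H)) T :=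
  forall xi eta, square_summable xi -> square_summable eta ->
    uw_pairing xi eta @ F --> uw_pairing xi eta T.

(* Ultraweak continuity on [M]. *)
Definition normal_on M f :=
  forall (F : set_system (H -> H)) T, ProperFilter F -> F M -> M T ->
    ultraweak_cvg F T -> (f : _ -> R[i]^o) @ F --> (f T : R[i]^o).

(* States of the operator system [A]; the values of [f] outside [A] are
   irrelevant. *)
Definition state_on A f :=
  [/\ forall (a : R[i]) S T, A S -> A T -> f (a *: S + T) = a * f S + f T,
      forall T, A T -> positive_op T -> 0 <= f T
    & f id = 1].

Definition tracial_von_neumann_algebra M f :=
  [/\ von_neumann_algebra M,
      state_on M f,
      normal_on M f,
      forall T, M T -> f (adj T \o T) = 0 -> T = 0
    & forall S T, M S -> M T -> f (S \o T) = f (T \o S)].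

Definition norm2 f T : R := Num.sqrt (complex.Re (f (adj T \o T))).

Definition unitary T := adj T \o T = id /\ T \o adj T = id.

End Operators.

Definition directed (I : Type) (le : I -> I -> Prop) :=
  [/\ inhabited I, forall i, le i i,
      forall i j k, le i j -> le j k -> le i k
    & forall i j, exists k, le i k /\ le j k].

Definition tails (I : Type) (le : I -> I -> Prop) : set_system I :=
  [set B | exists i, forall j, le i j -> B j].

Definition property_Gamma (R : realType) (H : hilbertType R)
    (M : set (H -> H)) (tau : (H -> H) -> R[i]) :=
  exists (I : Type) (le : I -> I -> Prop) (u : I -> H -> H),
  [/\ directed le,
      forall i, M (u i) /\ unitary (u i),
      ultraweak_cvg (u @ tails le) 0
    & forall x, M x ->
      norm2 tau (commutator x (u i)) @[i --> tails le] --> (0 : R)].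

(* The standard form [M] in [L^2 M] in [L^1 M] of a tracial von Neumann algebra.
   [L2] is the completion of [M] for the inner product [tau (y^* x)] and [L1]
   its completion for the norm [tau |x|], which determine them up to unique
   isomorphism; [hat] is the inclusion of [M] in [L2] and [incl] that of [L2] in
   [L1]. The left multiplication operators [lmul x] and the conjugation [J] are
   the continuous extensions of their restrictions to the image of [hat]. The
   functions [hat] and [lmul] are meaningful on [M] only. *)
Record standard_form (R : realType) (H : hilbertType R) (M : set (H -> H))
    (tau : (H -> H) -> R[i]) := StandardForm {
  L2 : hilbertType R ;
  L1 : completeNormedModType R[i] ;
  hat : (H -> H) -> L2 ;
  incl : L2 -> L1 ;
  lmul : (H -> H) -> L2 -> L2 ;
  J : L2 -> L2 ;
  hat_linear : forall (a : R[i]) x y, M x -> M y ->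
    hat (a *: x + y) = a *: hat x + hat y ;
  hat_dotp : forall x y, M x -> M y -> dotp (hat x) (hat y) = tau (adj y \o x) ;
  hat_dense : dense (hat @` M) ;
  incl_linear : linear incl ;
  incl_continuous : continuous incl ;
  incl_norm : forall x a, M x -> M a -> is_absolute_value x a ->
    `|incl (hat x)| = tau a ;
  incl_dense : dense (incl @` (hat @` M)) ;
  lmul_bounded : forall x, M x -> bounded_op (lmul x) ;
  lmul_hat : forall x y, M x -> M y -> lmul x (hat y) = hat (x \o y) ;
  J_continuous : continuous J ;
  J_hat : forall x, M x -> J (hat x) = hat (adj x)
}.

Arguments hat {R H M tau} s _.
Arguments incl {R H M tau} s _.
Arguments lmul {R H M tau} s _ _.
Arguments J {R H M tau} s _.

Section ProperProximality.
Context {R : realType} {H : hilbertType R}.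
Context {M : set (H -> H)} {tau : (H -> H) -> R[i]}.
Variable E : standard_form M tau.
Implicit Types T : L2 E -> L2 E.

Definition norm_infty_1 T : R :=
  sup [set rnorm (incl E (T (hat E x))) | x in [set x | M x /\ op_norm x <= 1]].

Definition K_infty_1 : set (L2 E -> L2 E) :=
  [set T | bounded_op T /\ forall e : R, 0 < e ->
    exists2 K, compact_op K & norm_infty_1 (T - K) < e].

Definition JopJ (x : H -> H) : L2 E -> L2 E := J E \o lmul E x \o J E.

Definition SS : set (L2 E -> L2 E) :=
  [set T | bounded_op T /\ forall x, M x ->
    K_infty_1 (commutator T (JopJ x))].

Definition central_on_SS (phi : (L2 E -> L2 E) -> R[i]) :=
  forall x T, M x -> SS T -> phi (lmul E x \o T) = phi (T \o lmul E x).

Definition properly_proximal :=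
  ~ exists phi : (L2 E -> L2 E) -> R[i],
      [/\ state_on SS phi, central_on_SS phi & normal_on M (phi \o lmul E)].

End ProperProximality.

(* Main.v *)
From HB Require Import structures.
Require Import Defs.
From mathcomp Require Import all_boot all_order all_algebra.
From mathcomp Require Import all_classical all_reals.
From mathcomp Require Import topology normedtype sequences.
From mathcomp Require Import complex ring lra.

Import Order.TTheory GRing.Theory Num.Theory.
Import numFieldNormedType.Exports.

Local Open Scope classical_set_scope.
Local Open Scope ring_scope.
Local Open Scope complex_scope.

(** A net of unitaries [u i] witnessing (Gamma) produces the central state
    directly.  Let [h i] be the unit vector of [L2] given by [u i] and let
    [phi T] be the limit of [dotp (T (h i)) (h i)] along an ultrafilter finer
    than the tails of the net ([vector_state_limit]).

    On [M] the functional [phi] is the trace, since [tau (u^* x u) = tau x]; so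
    it is normal there.  For centrality, let [x] be in [M].  As the commutators
    [x u - u x] and [x^* u - u x^*] tend to zero in 2-norm, and as right
    multiplication by [x] is [J x^* J], the number [phi (x T) - phi (T x)] is
    the limit of [- dotp ([T, J x^* J] (h i)) (h i)] ([vector_state_central]).
    The commutator lies in the closure of the compact operators for the norm
    from [M] to [L1], and the diagonal coefficients of such an operator tend to
    zero ([K_infty_1_diag_cvg0]):
    - for a compact operator because [h i] tends weakly to zero
      ([hat_weak0], [compact_diag_cvg0]);
    - in the closure because a unitary [u] of [M] satisfies
      [|dotp v u| <= ||v||_1] for [v] in [L2] ([rnorm_dotp_unitary]), so that an
      error which is small from [M] to [L1] has small diagonal coefficients.

    The last inequality amounts to [|tau z| <= tau |z|] for [z] in [M]
    ([rnorm_trace_le_modulus]).  The norm of [L1] is only known on the elements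
    whose absolute value lies in [M], so absolute values have to be constructed.
    Instead of functional calculus and polar decomposition, two fixed points
    are used: the square root of [z^* z] ([contraction_modulus]) and the inverse
    of [|z| + e] ([vn_resolvent]), both limits of operator iterations dominated
    by a convergent scalar iteration ([vn_majorized_iteration]). *)

(** * Real-valued norms and inner products *)

Section HilbertNorm.
Context {R : realType}.

Section Normed.
Context {V : normedModType R[i]}.
Implicit Types u v : V.

Lemma rnormE v : `|v| = (rnorm v)%:C.
Proof. by rewrite /rnorm RRe_real // ger0_real. Qed.

Lemma rnorm_ge0 v : 0 <= rnorm v.
Proof. by rewrite -ler0c -rnormE. Qed.

Lemma rnormD u v : rnorm (u + v) <= rnorm u + rnorm v.
Proof. by rewrite -lecR rmorphD /= -!rnormE ler_normD. Qed.

Lemma rnormN v : rnorm (- v) = rnorm v.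
Proof. by rewrite /rnorm normrN. Qed.

Lemma rnormB u v : rnorm (u - v) = rnorm (v - u).
Proof. by rewrite -rnormN opprB. Qed.

Lemma rnorm0 : rnorm (0 : V) = 0.
Proof. by rewrite /rnorm normr0. Qed.

Lemma rnorm_eq0 v : rnorm v = 0 -> v = 0.
Proof. by move=> h; apply: normr0_eq0; rewrite rnormE h. Qed.

Lemma rnormZ (a : R[i]) v : rnorm (a *: v) = rnorm (a : R[i]^o) * rnorm v.
Proof.
by apply/eqP; rewrite -(inj_eq (@complexI R)) rmorphM /= -!rnormE normrZ.
Qed.

Lemma cvg_rnormP {T : Type} {F : set_system T} {FF : Filter F} (f : T -> V) l :
  f x @[x --> F] --> l <-> rnorm (f x - l) @[x --> F] --> (0 : R).
Proof.
split=> [/cvgrPdist_lt fl|/cvgrPdist_lt fl]; apply/cvgrPdist_lt => e e0.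
- have e0' : 0 < e%:C by rewrite ltcE /= eqxx.
  move: (fl _ e0'); apply: filterS => x.
  by rewrite rnormE ltcR sub0r normrN ger0_norm ?rnorm_ge0// rnormB.
- have [e0' eE] : 0 < complex.Re e /\ e = (complex.Re e)%:C.
    by case: e e0 => a b; rewrite ltcE /= => /andP[/eqP -> ->].
  move: (fl _ e0'); apply: filterS => x.
  by rewrite eE rnormE ltcR sub0r normrN ger0_norm ?rnorm_ge0// rnormB.
Qed.

Lemma rnorm_lipschitz u v : `|rnorm u - rnorm v| <= rnorm (u - v).
Proof.
have h (x y : V) : rnorm x <= rnorm (x - y) + rnorm y.
  by rewrite -{1}(subrK y x) rnormD.
by rewrite ler_norml lerBlDr h andbT lerNl opprB lerBlDr rnormB h.
Qed.

Lemma rnorm_continuous : continuous (@rnorm R V).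
Proof.
move=> v; have /cvg_rnormP h : id x @[x --> v] --> v by exact: cvg_id.
apply/cvgrPdist_le => e e0; move/cvgrPdist_lt : h => /(_ e e0).
apply: filterS => x /=; rewrite sub0r normrN ger0_norm ?rnorm_ge0// => h.
by rewrite (le_trans (rnorm_lipschitz _ _))// rnormB ltW.
Qed.

End Normed.

Lemma rnorm_real (r : R) : rnorm (r%:C : R[i]^o) = `|r|.
Proof. by rewrite /rnorm normc_def /= expr0n addr0 sqrtr_sqr. Qed.

Lemma Re_le_rnorm (z : R[i]) : complex.Re z <= rnorm (z : R[i]^o).
Proof.
by rewrite (le_trans (ler_norm _))// -lecR -rnormE normc_ge_Re.
Qed.

Section Hilbert.
Context {V : hilbertType R}.
Implicit Types u v w : V.

Lemma dotpDl u v w : dotp (u + v) w = dotp u w + dotp v w.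
Proof. exact: linearDl. Qed.

Lemma dotpDr u v w : dotp u (v + w) = dotp u v + dotp u w.
Proof. exact: linearDr. Qed.

Lemma dotpBl u v w : dotp (u - v) w = dotp u w - dotp v w.
Proof. exact: linearBl. Qed.

Lemma dotpBr u v w : dotp u (v - w) = dotp u v - dotp u w.
Proof. exact: linearBr. Qed.

Lemma dotpZl (a : R[i]) u v : dotp (a *: u) v = a * dotp u v.
Proof. exact: linearZl_LR. Qed.

Lemma dotpZr (a : R[i]) u v : dotp u (a *: v) = Num.conj a * dotp u v.
Proof. exact: linearZr_LR. Qed.

Lemma dotp0l v : dotp 0 v = 0.
Proof. exact: linear0l. Qed.

Lemma dotp0r v : dotp v 0 = 0.
Proof. exact: linear0r. Qed.

Lemma dotpC u v : dotp u v = Num.conj (dotp v u).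
Proof. by rewrite hermC /= expr0 mul1r. Qed.

Lemma dotp_rnorm v : dotp v v = (rnorm v ^+ 2)%:C.
Proof. by rewrite dotp_norm rnormE rmorphXn. Qed.

Lemma rnorm_dotp v : rnorm (dotp v v : R[i]^o) = rnorm v ^+ 2.
Proof. by rewrite dotp_rnorm rnorm_real ger0_norm// exprn_ge0// rnorm_ge0. Qed.

Lemma Re_dotp v : complex.Re (dotp v v) = rnorm v ^+ 2.
Proof. by rewrite dotp_rnorm. Qed.

Lemma dotp_inj u v : (forall w, dotp u w = dotp v w) -> u = v.
Proof.
move=> h; apply/eqP; rewrite -subr_eq0 -normr_eq0 -sqrf_eq0 -dotp_norm.
by rewrite dotpBl h subrr.
Qed.

Lemma cauchy_schwarz u v : rnorm (dotp u v : R[i]^o) <= rnorm u * rnorm v.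
Proof.
have [->|v0] := eqVneq v 0; first by rewrite dotp0r !rnorm0 mulr0.
have rv0 : 0 < rnorm v.
  rewrite lt_neqAle rnorm_ge0 andbT eq_sym.
  by apply: contra_neq v0 => /rnorm_eq0.
rewrite -ler_sqr ?nnegrE ?mulr_ge0 ?rnorm_ge0// exprMn.
have : 0 <= dotp (dotp v v *: u - dotp u v *: v)
    (dotp v v *: u - dotp u v *: v).
  by rewrite dotp_norm exprn_ge0.
rewrite dotpBl !dotpBr !dotpZl !dotpZr (dotpC v u).
rewrite !dotp_rnorm.
rewrite !(conj_Creal (x := _%:C)) ?complex_real//.
set d := dotp u v; set A := rnorm u ^+ 2; set B := rnorm v ^+ 2.
have dE : d * Num.conj d = (rnorm (d : R[i]^o) ^+ 2)%:C.
  by rewrite -normCK (rnormE (d : R[i]^o)) rmorphXn.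
rewrite (mulrC (Num.conj d)) [d * (_ * _)]mulrCA [d * (_ * _)]mulrA dE.
rewrite [X in _ - (_ - X)]mulrC subrr subr0 -!rmorphM -rmorphB /= ler0c.
rewrite -mulrBr pmulr_rge0 ?exprn_gt0// subr_ge0 => /le_trans; apply.
by rewrite mulrC.
Qed.

End Hilbert.

End HilbertNorm.

(** * Linear maps, convergence and dense sets *)

Section Linear.
Context {K : numFieldType} {V W : lmodType K} {T : V -> W}.
Hypothesis linT : linear T.

Lemma linD u v : T (u + v) = T u + T v.
Proof. by have := linT 1 u v; rewrite !scale1r. Qed.

Lemma lin0 : T 0 = 0.
Proof. by apply: (addIr (T 0)); rewrite -linD !add0r. Qed.

Lemma linZ a u : T (a *: u) = a *: T u.
Proof. by have := linT a u 0; rewrite !addr0 lin0 addr0. Qed.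

Lemma linN u : T (- u) = - T u.
Proof. by rewrite -scaleN1r linZ scaleN1r. Qed.

Lemma linB u v : T (u - v) = T u - T v.
Proof. by rewrite linD linN. Qed.

End Linear.

Section Convergence.
Context {R : realType}.

Lemma cvg_squeeze0 {T : Type} {F : set_system T} {FF : Filter F}
    (f g : T -> R) :
  (forall x, 0 <= f x <= g x) -> g x @[x --> F] --> (0 : R) ->
  f x @[x --> F] --> (0 : R).
Proof.
move=> fg; apply: squeeze_cvgr; last exact: cvg_cst.
by near=> x; exact: fg.
Unshelve. all: by end_near. Qed.

Lemma cvg_rnorm_le {V : normedModType R[i]} {T : Type} {F : set_system T}
    {FF : Filter F} (f : T -> V) (l : V) (g : T -> R) :
  (forall x, rnorm (f x - l) <= g x) -> g x @[x --> F] --> (0 : R) ->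
  f x @[x --> F] --> l.
Proof.
move=> fg g0; apply/cvg_rnormP; apply: cvg_squeeze0 g0 => x.
by rewrite rnorm_ge0 fg.
Qed.

Lemma cvg_dotpl {V : hilbertType R} {T : Type} {F : set_system T}
    {FF : Filter F} (f : T -> V) (l v : V) :
  f x @[x --> F] --> l ->
  (dotp (f x) v : R[i]^o) @[x --> F] --> (dotp l v : R[i]^o).
Proof.
move=> /cvg_rnormP fl.
apply: (@cvg_rnorm_le _ _ _ _ _ _ (fun x => rnorm (f x - l) * rnorm v)).
  by move=> x; rewrite -dotpBl cauchy_schwarz.
by rewrite -(mul0r (rnorm v)); apply: cvgMl.
Qed.

Lemma cvg_dotpr {V : hilbertType R} {T : Type} {F : set_system T}
    {FF : Filter F} (f : T -> V) (l v : V) :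
  f x @[x --> F] --> l ->
  (dotp v (f x) : R[i]^o) @[x --> F] --> (dotp v l : R[i]^o).
Proof.
move=> /cvg_rnormP fl.
apply: (@cvg_rnorm_le _ _ _ _ _ _ (fun x => rnorm v * rnorm (f x - l))).
  by move=> x; rewrite -dotpBr cauchy_schwarz.
by rewrite -(mulr0 (rnorm v)); apply: cvgMr.
Qed.

Lemma dense_ge0 {V : normedModType R[i]} (D : set V) (h : V -> R) :
  dense D -> continuous h -> (forall v, D v -> 0 <= h v) ->
  forall v, 0 <= h v.
Proof.
move=> dD ch h0 v; rewrite leNgt; apply/negP => hv.
have [] := dD [set w | h w < 0]; first by exists v.
  apply: (@open_comp _ _ h [set x : R | x < 0]); last exact: open_lt.
  by move=> x _; exact: ch.
by move=> w [/= hw /h0]; rewrite leNgt hw.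
Qed.

Lemma dense_approx {V : normedModType R[i]} (D : set V) (v : V) (e : R) :
  dense D -> 0 < e -> exists2 w, D w & rnorm (v - w) < e.
Proof.
move=> dD e0; apply: contrapT => far.
suff : 0 <= rnorm (v - v) - e by rewrite subrr rnorm0 sub0r oppr_ge0 leNgt e0.
apply: (dense_ge0 D (fun w => rnorm (v - w) - e) dD) => [w|w Dw].
  apply: cvgB; last exact: cvg_cst.
  apply: (@continuous_comp _ _ _ (fun w => v - w) (@rnorm R V)).
    by apply: cvgB; [exact: cvg_cst|exact: cvg_id].
  exact: rnorm_continuous.
by rewrite subr_ge0 leNgt; apply/negP => vw; apply: far; exists w.
Qed.

Lemma dense_eq {V W : normedModType R[i]} (D : set V) (f g : V -> W) :
  dense D -> continuous f -> continuous g ->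
  (forall v, D v -> f v = g v) -> forall v, f v = g v.
Proof.
move=> dD cf cg fg v; apply/eqP; rewrite -subr_eq0; apply/eqP.
apply: rnorm_eq0; apply/eqP; rewrite eq_le rnorm_ge0 andbT -oppr_ge0.
apply: (dense_ge0 _ (fun v => - rnorm (f v - g v)) dD) => [w|w Dw].
  apply: cvgN.
  apply: (@continuous_comp _ _ _ (fun v => f v - g v) (@rnorm R W)).
    by apply: cvgB; [exact: cf|exact: cg].
  exact: rnorm_continuous.
by rewrite fg// subrr rnorm0 oppr0.
Qed.

Lemma continuous_linear_rnorm {V W : normedModType R[i]} {f : V -> W} :
  linear f -> continuous f ->
  exists2 C : R, 0 <= C & forall v, rnorm (f v) <= C * rnorm v.
Proof.
move=> lf cf.
pose F : {linear V -> W} := HB.pack f (GRing.isLinear.Build _ _ _ _ f lf).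
have /linear_boundedP/pinfty_ex_gt0[r r0 fr] : bounded_near F (nbhs 0).
  exact/continuous_linear_bounded/cf.
exists (rnorm (r : R[i]^o)) => [|v]; first exact: rnorm_ge0.
rewrite -lecR rmorphM /= -!rnormE (le_trans (fr v))//.
by rewrite ler_wpM2r// real_ler_norm// gtr0_real.
Qed.

Lemma linear_rnorm_continuous {V W : normedModType R[i]} {f : V -> W} (C : R) :
  linear f -> (forall v, rnorm (f v) <= C * rnorm v) -> continuous f.
Proof.
move=> lf fC v; apply: (@cvg_rnorm_le _ _ _ _ _ _ (fun x => C * rnorm (x - v))).
  by move=> x; rewrite -(linB lf).
rewrite -(mulr0 C); apply: cvgMr.
by apply/(cvg_rnormP (fun x => x)); exact: cvg_id.
Qed.

End Convergence.

(** * Bounded operators and bicommutants *)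

Section BoundedOperators.
Context {R : realType} {V : hilbertType R}.
Implicit Types (S T : V -> V).

Lemma bounded_op_id : bounded_op (id : V -> V).
Proof. by split=> // v; exact: cvg_id. Qed.

Lemma bounded_op_comp {S T} :
  bounded_op S -> bounded_op T -> bounded_op (S \o T).
Proof.
move=> [lS cS] [lT cT]; split=> [a u v|v] /=; first by rewrite lT lS.
by apply: continuous_comp; [exact: cT|exact: cS].
Qed.

Lemma bounded_op_lin (a : R[i]) {S T} :
  bounded_op S -> bounded_op T -> bounded_op (a *: S + T).
Proof.
move=> [lS cS] [lT cT]; split=> [b u v|v].
  rewrite -!/((a *: S + T) _) !fctE lS lT !scalerDr !scalerA mulrC.
  by rewrite -!addrA; congr (_ + _); rewrite addrCA.
apply: (@cvgD _ _ _ _ _ (a \*: S) T); last exact: cT.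
by apply: cvgZr; exact: cS.
Qed.

Lemma bounded_op_rnorm {T} : bounded_op T ->
  exists2 C : R, 0 <= C & forall v, rnorm (T v) <= C * rnorm v.
Proof. by move=> [lT cT]; exact: continuous_linear_rnorm. Qed.

Variable (A : set (V -> V)).
Hypothesis Abd : A `<=` bounded_op.

Lemma commutant_id : commutant A id.
Proof. by split=> //; exact: bounded_op_id. Qed.

Lemma commutant_comp {S T} :
  commutant A S -> commutant A T -> commutant A (S \o T).
Proof.
move=> [bS cS] [bT cT]; split=> [|X AX]; first exact: bounded_op_comp.
by rewrite -compA cT// compA cS.
Qed.

Lemma commutant_lin (a : R[i]) {S T} :
  commutant A S -> commutant A T -> commutant A (a *: S + T).
Proof.
move=> [bS cS] [bT cT]; split=> [|X AX]; first exact: bounded_op_lin.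
have [lX _] := Abd _ AX; apply/funext => v /=.
rewrite -!/((a *: S + T) _) !fctE lX.
by rewrite -[S (X v)]/((S \o X) v) -[T (X v)]/((T \o X) v) cS// cT.
Qed.

End BoundedOperators.

Section Adjoints.
Context {R : realType} {V : hilbertType R}.
Implicit Types (S T : V -> V).

Lemma is_adjoint_inj {T S S'} : is_adjoint T S -> is_adjoint T S' -> S = S'.
Proof.
move=> h h'; apply/funext => v; apply: dotp_inj => w.
by rewrite dotpC -h h' -dotpC.
Qed.

Lemma adj_eq {T S} : is_adjoint T S -> adj T = S.
Proof.
by move=> h; apply: (is_adjoint_inj _ h); apply: xgetPex; exists S.
Qed.

End Adjoints.

Section Algebra.
Context {R : realType} {H : hilbertType R} {M : set (H -> H)}.
Hypothesis vM : von_neumann_algebra M.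

Lemma vn_bounded {T} : M T -> bounded_op T.
Proof. by case: vM => + _ _; apply. Qed.

Lemma vn_adj {T} : M T -> M (adj T).
Proof. by case: vM => _ + _; apply. Qed.

Lemma commutant_bounded (A : set (H -> H)) : commutant A `<=` bounded_op.
Proof. by move=> T []. Qed.

Lemma vn_id : M id.
Proof. by case: vM => _ _ <-; exact/commutant_id. Qed.

Lemma vn_comp {S T} : M S -> M T -> M (S \o T).
Proof. by case: vM => _ _ <-; exact: commutant_comp. Qed.

Lemma vn_lin (a : R[i]) {S T} : M S -> M T -> M (a *: S + T).
Proof.
by case: vM => _ _ <-; apply: commutant_lin; exact: commutant_bounded.
Qed.

Lemma vn0 : M 0.
Proof.
have := vn_lin (-1) vn_id vn_id.
by rewrite scaleN1r addNr.
Qed.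

Lemma vnZ (a : R[i]) {T} : M T -> M (a *: T).
Proof.
by move=> MT; rewrite -(addr0 (a *: T)); apply: vn_lin => //; exact: vn0.
Qed.

Lemma vnD {S T} : M S -> M T -> M (S + T).
Proof. by move=> MS MT; rewrite -(scale1r S); exact: vn_lin. Qed.

Lemma vnB {S T} : M S -> M T -> M (S - T).
Proof. by move=> MS MT; rewrite addrC -scaleN1r; exact: vn_lin. Qed.

(** The increments of [T] are dominated by those of a convergent real sequence,
    so [T n v] is Cauchy for every [v].  The pointwise limit still commutes with
    the commutant of [M], whose elements are continuous; being in the
    bicommutant, it is in [M]. *)
Lemma vn_limit (T : nat -> H -> H) (r : nat -> R) (C : R) :
  (forall n, M (T n)) -> cvgn r ->
  (forall n v, rnorm (T n.+1 v - T n v) <= (r n.+1 - r n) * rnorm v) ->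
  (forall n v, rnorm (T n v) <= C * rnorm v) ->
  exists S, [/\ M S, forall v, T n v @[n --> \oo] --> S v &
    forall v, rnorm (S v) <= C * rnorm v].
Proof.
move=> MT cr Tr TC.
have tele n k v :
    rnorm (T (n + k)%N v - T n v) <= (r (n + k)%N - r n) * rnorm v.
  elim: k => [|k ih]; first by rewrite addn0 !subrr rnorm0 mul0r.
  rewrite addnS -(subrKA (T (n + k)%N v)) (le_trans (rnormD _ _))//.
  by rewrite -[r _ - r n](subrKA (r (n + k)%N)) mulrDl lerD.
have cT v : cvgn (fun n => T n v).
  apply/cauchy_cvgP/cauchy_exP => e e0.
  have [e0' eE] : 0 < complex.Re e /\ e = (complex.Re e)%:C.
    by case: e e0 => a b; rewrite ltcE /= => /andP[/eqP -> ->].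
  pose d := complex.Re e / (2 * (1 + rnorm v)).
  have v0 : 0 < 1 + rnorm v by rewrite ltr_wpDr ?rnorm_ge0.
  have d0 : 0 < d by rewrite divr_gt0// mulr_gt0.
  move/cvgrPdist_lt : (cr) => /(_ _ d0)[N _ hN].
  exists (T N v); exists N => // n /= Nn.
  rewrite -ball_normE /= eE rnormE ltcR rnormB -(subnKC Nn).
  rewrite (le_lt_trans (tele _ _ _))// subnKC//.
  have rd : r n - r N <= 2 * d.
    have := hN _ Nn; have := hN _ (leqnn N); rewrite /= !ltr_norml; lra.
  rewrite (@le_lt_trans _ _ (2 * d * rnorm v))//.
    by rewrite ler_wpM2r ?rnorm_ge0.
  have <- : 2 * d * (1 + rnorm v) = complex.Re e.
    by rewrite /d; field; exact: lt0r_neq0.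
  have d2 : 0 < 2 * d by rewrite mulr_gt0.
  nra.
pose S v := limn (fun n => T n v).
have cS v : T n v @[n --> \oo] --> S v by exact: cT.
have SC v : rnorm (S v) <= C * rnorm v.
  have h : rnorm (T n v) @[n --> \oo] --> rnorm (S v).
    by apply: (@continuous_cvg _ _ _ _ _ _ (@rnorm R H)) => //;
      exact: rnorm_continuous.
  by apply: (cvgr_to_le h); apply: nearW => n; exact: TC.
have lS : linear S.
  move=> a u v.
  have h : T n (a *: u + v) @[n --> \oo] --> a *: S u + S v.
    rewrite (_ : (fun n => _) = (fun n => a *: T n u + T n v)); last first.
      by apply/funext => n; have [lT _] := vn_bounded (MT n); rewrite lT.
    by apply: cvgD => //; apply: cvgZr.
  exact: cvg_unique (cS _) h.
have bS : bounded_op S by split=> //; exact: linear_rnorm_continuous SC.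
exists S; split=> //.
have [_ _ <-] := vM; split=> // X [[lX cX] comX]; apply/funext => v /=.
have h : T n (X v) @[n --> \oo] --> X (S v).
  rewrite (_ : (fun n => _) = (fun n => X (T n v))); last first.
    apply/funext => n; rewrite -[LHS]/((T n \o X) v).
    by rewrite -comX.
  by apply: (@continuous_cvg _ _ _ _ _ _ X); [exact: cX|].
exact: cvg_unique (cS _) h.
Qed.

End Algebra.

(** * Square roots and resolvents in a von Neumann algebra *)

Section Iteration.
Context {R : realType} {H : hilbertType R} {M : set (H -> H)}.
Hypothesis vM : von_neumann_algebra M.

Definition op_bound (t : R) (T : H -> H) :=
  forall v, rnorm (T v) <= t * rnorm v.

(** The majorant principle: if every step of the operator iteration is bounded
    by the corresponding step of a scalar iteration which increases from 0 and
    stays below [C], then the operator iteration converges pointwise.  It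
    stands in for the power series of an operator with nonnegative scalar
    coefficients. *)
Lemma vn_majorized_iteration (Phi : (H -> H) -> H -> H) (phi : R -> R) (C : R) :
  0 <= C ->
  (forall T, M T -> M (Phi T)) ->
  (forall t, 0 <= t <= C -> 0 <= phi t <= C) ->
  (forall s t, 0 <= s -> s <= t -> phi s <= phi t) ->
  (forall T t, M T -> 0 <= t -> op_bound t T -> op_bound (phi t) (Phi T)) ->
  (forall S T s t, M S -> M T -> 0 <= s <= t -> op_bound s S -> op_bound t T ->
    op_bound (t - s) (T - S) -> op_bound (phi t - phi s) (Phi T - Phi S)) ->
  exists S, [/\ M S, op_bound C S,
    forall v, iter n Phi 0 v @[n --> \oo] --> S v
    & forall n, M (iter n Phi 0) /\ op_bound C (iter n Phi 0)].
Proof.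
move=> C0 MPhi phiC phi_homo Phib PhiB.
pose T n := iter n Phi 0; pose r n := iter n phi 0.
have MT n : M (T n) by elim: n => [|n ih] /=; [exact: (vn0 vM)|exact: MPhi].
have r0C n : 0 <= r n <= C.
  by elim: n => [|n ih] /=; [rewrite lexx|exact: phiC].
have ndr n : r n <= r n.+1.
  elim: n => [|n ih] /=; first by have /andP[] := r0C 1%N.
  by apply: phi_homo => //; have /andP[] := r0C n.
have r0t n : 0 <= r n <= r n.+1 by rewrite ndr andbT; have /andP[] := r0C n.
have Tr n : op_bound (r n) (T n).
  elim: n => [|n ih] /=; last first.
    by apply: (Phib _ _ (MT n)) => //; have /andP[] := r0C n.
  by move=> v; rewrite rnorm0 mul0r.
have dT n : op_bound (r n.+1 - r n) (T n.+1 - T n).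
  elim: n => [|n ih]; last first.
    exact: PhiB (MT n) (MT n.+1) (r0t n) (Tr n) (Tr n.+1) ih.
  by move=> v; rewrite !subr0; exact: Tr.
have cr : cvgn r.
  apply: nondecreasing_is_cvgn; first exact/nondecreasing_seqP.
  by exists C => _ [n _ <-]; have /andP[] := r0C n.
have TC n : op_bound C (T n).
  move=> v; rewrite (le_trans (Tr n v))// ler_wpM2r ?rnorm_ge0//.
  by have /andP[] := r0C n.
have [S [MS cS SC]] := vn_limit vM T r C MT cr dT TC.
by exists S; split=> // n; split; [exact: MT|exact: TC].
Qed.

End Iteration.

Section Modulus.
Context {R : realType} {H : hilbertType R} {M : set (H -> H)}.
Hypothesis vM : von_neumann_algebra M.
Hypothesis adjM : forall T, M T -> is_adjoint T (adj T).
Implicit Types T : H -> H.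

Lemma positive_sub_contraction {Y : H -> H} : is_adjoint Y Y -> op_bound 1 Y ->
  positive_op (id - Y : H -> H).
Proof.
move=> Ys Y1 v; rewrite -[(id - Y) v]/(v - Y v) dotpBl.
have dr : dotp (Y v) v \is Num.real by apply/CrealP; rewrite -dotpC Ys.
rewrite dotp_rnorm -(RRe_real dr) -rmorphB ler0c subr_ge0.
rewrite (le_trans (Re_le_rnorm _))// (le_trans (cauchy_schwarz _ _))//.
by rewrite expr2 ler_wpM2r ?rnorm_ge0// (le_trans (Y1 _))// mul1r.
Qed.

Lemma adj_contraction {x} : M x -> op_bound 1 x -> op_bound 1 (adj x).
Proof.
move=> Mx xb v; rewrite mul1r; have [->//|n0] := eqVneq (rnorm (adj x v)) 0.
  exact: rnorm_ge0.
have n1 : 0 < rnorm (adj x v) by rewrite lt_neqAle rnorm_ge0 eq_sym n0.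
rewrite -(ler_pM2l n1) -expr2 -rnorm_dotp -(adjM _ Mx).
rewrite (le_trans (cauchy_schwarz _ _))// ler_wpM2r ?rnorm_ge0//.
by have := xb (adj x v); rewrite mul1r.
Qed.

(** One has [|v - x^*x v|^2 = |v|^2 - 2 |x v|^2 + |x^*x v|^2], and
    [|x^*x v| <= |x v|]. *)
Lemma sub_adj_contraction {x} : M x -> op_bound 1 x ->
  op_bound 1 (id - (adj x \o x)).
Proof.
move=> Mx x1 v; rewrite mul1r -ler_sqr ?nnegrE ?rnorm_ge0//.
rewrite -![rnorm _ ^+ 2]Re_dotp.
rewrite -[(id - _) v]/(v - adj x (x v)) dotpBl !dotpBr.
rewrite -(adjM _ Mx) (dotpC (adj x (x v)) v) -(adjM _ Mx).
have xx := adj_contraction Mx x1 (x v).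
rewrite (dotp_rnorm (x v)) conj_Creal ?complex_real// dotp_rnorm.
rewrite !raddfB /= Re_dotp.
rewrite mul1r -ler_sqr ?nnegrE ?rnorm_ge0// in xx.
have := sqr_ge0 (rnorm (x v)); lra.
Qed.

(** The operator [id - Y] is the absolute value of [x]: with [B = 1 - x^*x], the
    equation [(1 - Y)^2 = x^*x] is the fixed point equation [Y = (B + Y^2) / 2],
    majorized by the map [t |-> (1 + t^2) / 2] of the unit interval.  The
    complement [Y] of the absolute value is what the resolvent needs. *)
Lemma contraction_modulus {x} : M x -> op_bound 1 x ->
  exists Y, [/\ M Y, is_adjoint Y Y, op_bound 1 Y
    & (id - Y) \o (id - Y) = adj x \o x].
Proof.
move=> Mx x1; pose B := id - (adj x \o x).
have MB : M B.
  apply: (vnB vM); first exact: (vn_id vM).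
  by apply: (vn_comp vM) => //; exact: (vn_adj vM).
have B1 : op_bound 1 B by exact: sub_adj_contraction.
have Bs : is_adjoint B B.
  move=> u v; change (dotp (u - adj x (x u)) v = dotp u (v - adj x (x v))).
  rewrite dotpBl dotpBr.
  by rewrite -(adjM _ Mx) [dotp (adj x _) _]dotpC -(adjM _ Mx) -dotpC.
pose h : R := 2^-1.
pose Phi T := h%:C *: (B + (T \o T)).
pose phi (t : R) := h * (1 + t ^+ 2).
have h0 : 0 < h by rewrite invr_gt0.
have hh : rnorm (h%:C : R[i]^o) = h by rewrite rnorm_real gtr0_norm.
have h2 : 2 * h = 1 by rewrite /h divff ?pnatr_eq0.
have [//||||||Y [MY Y1 cY TM]] := @vn_majorized_iteration _ _ _ vM Phi phi 1.
- by move=> T MT; apply/(vnZ vM)/(vnD vM) => //; exact: (vn_comp vM).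
- by move=> t /andP[t0 t1]; rewrite /phi; apply/andP; split; nra.
- by move=> s t s0 st; rewrite /phi; nra.
- move=> T t MT t0 Tt v; rewrite -[Phi T v]/(h%:C *: (B v + T (T v))).
  rewrite rnormZ hh /phi -mulrA ler_pM2l// (le_trans (rnormD _ _))//.
  rewrite mulrDl lerD//.
  by rewrite (le_trans (Tt _))// expr2 -mulrA ler_wpM2l.
- move=> S T s t MS MT /andP[s0 st] Ss Tt TS v.
  (* T^2 - S^2 = T (T - S) + (T - S) S holds even if S and T do not commute *)
  have [lT _] := vn_bounded vM MT.
  have -> : (Phi T - Phi S) v = h%:C *: (T ((T - S) v) + (T - S) (S v)).
    rewrite -[LHS]/(h%:C *: (B v + T (T v)) - h%:C *: (B v + S (S v))).
    rewrite -[(T - S) v]/(T v - S v) -[(T - S) (S v)]/(T (S v) - S (S v)).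
    by rewrite -scalerBr (linB lT) subrKA opprD addrACA subrr add0r.
  rewrite rnormZ hh /phi -mulrBr -mulrA ler_pM2l//.
  rewrite (le_trans (rnormD _ _))// opprD addrACA subrr add0r.
  have -> : (t ^+ 2 - s ^+ 2) * rnorm v =
    t * ((t - s) * rnorm v) + (t - s) * (s * rnorm v) by ring.
  rewrite lerD//.
    by rewrite (le_trans (Tt _))// ler_wpM2l// (le_trans s0).
  by rewrite (le_trans (TS _))// ler_wpM2l// subr_ge0.
pose T n := iter n Phi 0.
have Ts n : is_adjoint (T n) (T n).
  elim: n => [|n ih] u v; first by rewrite dotp0l dotp0r.
  change (dotp (h%:C *: (B u + T n (T n u))) v
    = dotp u (h%:C *: (B v + T n (T n v)))).
  rewrite dotpZl dotpZr conj_Creal ?complex_real// dotpDl dotpDr.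
  by rewrite Bs !ih.
have Ys : is_adjoint Y Y.
  move=> u v; apply: (@norm_cvg_unique _ R[i]^o (dotp (T n u) v @[n --> \oo])).
    exact: cvg_dotpl (cY u).
  rewrite (_ : (fun n => _) = (fun n => dotp u (T n v))).
    exact: cvg_dotpr (cY v).
  by apply/funext => n; rewrite Ts.
have cYY v : T n (T n v) @[n --> \oo] --> Y (Y v).
  pose g n := rnorm (T n v - Y v) + rnorm (T n (Y v) - Y (Y v)).
  apply: (@cvg_rnorm_le _ _ _ _ _ _ _ g).
    move=> n; have [/(vn_bounded vM)[lT _] T1] := TM n.
    rewrite -(subrKA (T n (Y v))) (le_trans (rnormD _ _))// lerD//.
    by rewrite -(linB lT) (le_trans (T1 _))// mul1r.
  by rewrite -(addr0 0); apply: cvgD; apply/cvg_rnormP; exact: cY.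
have YE v : Y v = h%:C *: (B v + Y (Y v)).
  have hv : T n.+1 v @[n --> \oo] --> Y v.
    by rewrite (cvg_shiftS (fun n => T n v)); exact: cY.
  apply: cvg_unique hv _ => //.
  by apply: cvgZr; apply: cvgD; [exact: cvg_cst|exact: cYY].
have [lY _] := vn_bounded vM MY.
exists Y; split=> //; apply/funext => v.
change (v - Y v - Y (v - Y v) = adj x (x v)).
have YE2 : Y v + Y v = v - adj x (x v) + Y (Y v).
  by rewrite {1 2}YE -mulr2n -scaler_nat scalerA -(rmorph_nat (real_complex R))
    -rmorphM h2 scale1r.
by rewrite (linB lY) opprB addrACA -opprD YE2 [v - _ + _]addrAC subKr.
Qed.

(** The Neumann series of [(1 + e - Y)^-1] consists of the iterates of
    [T |-> (1 + Y T) / (1 + e)]; the majorant [r |-> (1 + r) / (1 + e)] has the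
    fixed point [1 / e]. *)
Lemma vn_resolvent Y (e : R) : M Y -> op_bound 1 Y -> 0 < e ->
  exists2 D, M D & forall v, (1 + e)%:C *: D v - Y (D v) = v.
Proof.
move=> MY Y1 e0; have [lY _] := vn_bounded vM MY.
pose t := (1 + e)^-1.
have e1 : 0 < 1 + e by rewrite addr_gt0.
have t0 : 0 < t by rewrite invr_gt0.
have te : t * (1 + e) = 1 by rewrite mulVf// lt0r_neq0.
have ht : rnorm (t%:C : R[i]^o) = t by rewrite rnorm_real gtr0_norm.
pose Phi T := t%:C *: (id + (Y \o T)).
pose phi (r : R) := t * (1 + r).
have [||||||D [MD D1 cD TM]] := @vn_majorized_iteration _ _ _ vM Phi phi e^-1.
- by rewrite invr_ge0 ltW.
- move=> T MT; apply/(vnZ vM)/(vnD vM); first exact: (vn_id vM).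
  exact: (vn_comp vM).
- move=> r /andP[r0 re]; rewrite /phi mulr_ge0 ?addr_ge0 ?(ltW t0)//=.
  rewrite -(ler_pM2l e1) mulrA (mulrC _ t) te mul1r.
  by rewrite mulrDl mul1r divff ?lt0r_neq0// addrC lerD2r.
- by move=> s r s0 st; rewrite /phi ler_pM2l// lerD2l.
- move=> T r MT r0 Tr v; rewrite -[Phi T v]/(t%:C *: (v + Y (T v))).
  rewrite rnormZ ht /phi -mulrA ler_pM2l// (le_trans (rnormD _ _))//.
  by rewrite mulrDl mul1r lerD2l (le_trans (Y1 _))// mul1r Tr.
- move=> S T s r MS MT /andP[s0 sr] Ss Tr TS v.
  have -> : (Phi T - Phi S) v = t%:C *: Y ((T - S) v).
    rewrite -[LHS]/(t%:C *: (v + Y (T v)) - t%:C *: (v + Y (S v))).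
    rewrite -[(T - S) v]/(T v - S v).
    by rewrite -scalerBr (linB lY) opprD addrACA subrr add0r.
  rewrite rnormZ ht /phi -mulrBr -mulrA ler_pM2l//.
  by rewrite (le_trans (Y1 _))// mul1r opprD addrACA subrr add0r TS.
exists D => // v.
have YE : D v = t%:C *: (v + Y (D v)).
  have hv : iter n.+1 Phi 0 v @[n --> \oo] --> D v.
    by rewrite (cvg_shiftS (fun n => iter n Phi 0 v)); exact: cD.
  apply: cvg_unique hv _ => //.
  apply: cvgZr; apply: cvgD; first exact: cvg_cst.
  apply: (@continuous_cvg _ _ _ _ _ _ Y); last exact: cD.
  by have [_ cY] := vn_bounded vM MY; exact: cY.
by rewrite {1}YE scalerA -rmorphM mulrC te scale1r addrK.
Qed.

End Modulus.

(** * Faithful traces and adjoints *)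

Section Trace.
Context {R : realType} {H : hilbertType R}.
Context {M : set (H -> H)} {tau : (H -> H) -> R[i]}.
Hypothesis hM : tracial_von_neumann_algebra M tau.
Implicit Types x y z : H -> H.

Lemma tracial_vn : von_neumann_algebra M. Proof. by case: hM. Qed.
Let vM := tracial_vn.

Lemma trace_lin (a : R[i]) x y : M x -> M y ->
  tau (a *: x + y) = a * tau x + tau y.
Proof. by case: hM => _ [h _ _] _ _ _; exact: h. Qed.

Lemma trace0 : tau 0 = 0.
Proof.
have := trace_lin 1 0 0 (vn0 vM) (vn0 vM).
rewrite scale1r addr0 mul1r => /eqP.
by rewrite -subr_eq0 opprD addNKr oppr_eq0 => /eqP.
Qed.

Lemma trace_ge0 {x} : M x -> positive_op x -> 0 <= tau x.
Proof. by case: hM => _ [_ h _] _ _ _; exact: h. Qed.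

Lemma trace_id : tau id = 1.
Proof. by case: hM => _ []. Qed.

Lemma traceC {x y} : M x -> M y -> tau (x \o y) = tau (y \o x).
Proof. by case: hM => _ _ _ _; apply. Qed.

(** Faithfulness of the trace gives the existence of adjoints: the value of
    [adj] at an operator [x] of [M] without adjoint is 0, so [tau (x^* x) = 0]
    and [x] is 0, which has an adjoint. *)
Lemma tracial_adjP {x} : M x -> is_adjoint x (adj x).
Proof.
move=> Mx; have [h|h] := pselect (exists S, is_adjoint x S).
  exact: xgetPex.
have ax0 : adj x = 0 by apply: xgetPN => S hS; apply: h; exists S.
have -> : x = 0.
  case: hM => _ _ _ faithful _; apply: faithful => //.
  by rewrite ax0; exact: trace0.
by rewrite (_ : adj 0 = 0) => [u v|]; [|apply: adj_eq => u v];
  rewrite dotp0l dotp0r.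
Qed.

Lemma adjK {x} : M x -> adj (adj x) = x.
Proof.
move=> Mx; apply: adj_eq => u v.
by rewrite dotpC -(tracial_adjP Mx) -dotpC.
Qed.

Lemma tracial_adjPr {x} u v : M x -> dotp (adj x u) v = dotp u (x v).
Proof. by move=> Mx; rewrite dotpC -(tracial_adjP Mx) -dotpC. Qed.

Lemma adj_id : adj (id : H -> H) = id.
Proof. exact: adj_eq. Qed.

Lemma adj_comp {x y} : M x -> M y -> adj (x \o y) = adj y \o adj x.
Proof.
move=> Mx My; apply: adj_eq => u v /=.
by rewrite (tracial_adjP Mx) (tracial_adjP My).
Qed.

End Trace.

(** * The standard form and the duality between L1 and M *)

Lemma continuous_dotp_comp {R : realType} {V : hilbertType R} {f : V -> V} w :
  continuous f ->
  continuous (fun v => dotp (f v) w : R[i]^o).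
Proof. by move=> cf v; apply: cvg_dotpl; exact: cf. Qed.

Section StandardForm.
Context {R : realType} {H : hilbertType R}.
Context {M : set (H -> H)} {tau : (H -> H) -> R[i]}.
Hypothesis hM : tracial_von_neumann_algebra M tau.
Variable E : standard_form M tau.
Implicit Types x y z u : H -> H.
Let vM := tracial_vn hM.

Lemma hat0 : hat E 0 = 0.
Proof.
have := hat_linear E 1 (vn0 vM) (vn0 vM).
rewrite !scale1r addr0 => /eqP.
by rewrite -subr_eq0 opprD addNKr oppr_eq0 => /eqP.
Qed.

Lemma hatZ (a : R[i]) {x} : M x -> hat E (a *: x) = a *: hat E x.
Proof.
move=> Mx; rewrite -[a *: x]addr0 hat_linear// ?hat0 ?addr0//.
exact: vn0 vM.
Qed.

Lemma hatB {x y} : M x -> M y -> hat E (x - y) = hat E x - hat E y.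
Proof.
by move=> Mx My; rewrite addrC -scaleN1r hat_linear// scaleN1r addrC.
Qed.

Lemma traceE {x} : M x -> tau x = dotp (hat E x) (hat E id).
Proof. by move=> Mx; rewrite hat_dotp ?adj_id//; exact: (vn_id vM). Qed.

Lemma trace_adj {x} : M x -> tau (adj x) = Num.conj (tau x).
Proof.
move=> Mx; rewrite (traceE Mx) -dotpC hat_dotp//; exact: (vn_id vM).
Qed.

Lemma rnorm_hat {x} : M x -> rnorm (hat E x) = norm2 tau x.
Proof.
move=> Mx; rewrite /norm2 -(hat_dotp E Mx Mx) Re_dotp sqrtr_sqr.
by rewrite ger0_norm// rnorm_ge0.
Qed.

Lemma rnorm_hat_unitary {u} : M u -> unitary u -> rnorm (hat E u) = 1.
Proof.
by move=> Mu [uu _]; rewrite rnorm_hat// /norm2 uu (trace_id hM) sqrtr1.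
Qed.

Lemma JopJ_hat {x y} : M x -> M y ->
  JopJ (E := E) x (hat E y) = hat E (y \o adj x).
Proof.
move=> Mx My; have Ma := vn_adj vM.
rewrite /JopJ /= J_hat// lmul_hat//; last exact: Ma.
rewrite J_hat; last by apply: (vn_comp vM) => //; exact: Ma.
by rewrite (adj_comp hM)// ?(adjK hM)//; exact: Ma.
Qed.

Lemma JopJ_continuous {x} : M x -> continuous (JopJ (E := E) x).
Proof.
move=> Mx v; apply: (@continuous_comp _ _ _ (J E) (J E \o lmul E x)).
  exact: J_continuous.
apply: continuous_comp; last exact: J_continuous.
by have [_ +] := lmul_bounded E Mx; apply.
Qed.

(** On [hat E z] both sides are [tau (y^* x z)]; density extends this. *)
Lemma lmul_adj {x y} (v : L2 E) : M x -> M y ->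
  dotp (lmul E x v) (hat E y) = dotp v (hat E (adj x \o y)).
Proof.
move=> Mx My; have Max := vn_adj vM Mx; have May := vn_adj vM My.
apply: (@dense_eq _ _ R[i]^o _ (fun v => dotp (lmul E x v) (hat E y))
  (fun v => dotp v (hat E (adj x \o y))) (@hat_dense _ _ _ _ E))
  => [||_ [z Mz <-]].
- by have [_] := lmul_bounded E Mx; exact: continuous_dotp_comp.
- by apply: (@continuous_dotp_comp _ _ id) => w'; exact: cvg_id.
- have Mxy := vn_comp vM Max My; have Mxz := vn_comp vM Mx Mz.
  by rewrite lmul_hat// !hat_dotp// (adj_comp hM)// (adjK hM).
Qed.

(** On [hat E z] both sides are traces of the product of [x^*], [y^*] and [z] up
    to cyclic order. *)
Lemma JopJ_adj {x y} (v : L2 E) : M x -> M y ->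
  dotp (JopJ (E := E) x v) (hat E y) = dotp v (hat E (y \o x)).
Proof.
move=> Mx My; have Max := vn_adj vM Mx; have May := vn_adj vM My.
apply: (@dense_eq _ _ R[i]^o _ (fun v => dotp (JopJ (E := E) x v) (hat E y))
  (fun v => dotp v (hat E (y \o x))) (@hat_dense _ _ _ _ E))
  => [||_ [z Mz <-]].
- by apply: continuous_dotp_comp; exact: JopJ_continuous.
- by apply: (@continuous_dotp_comp _ _ id) => w'; exact: cvg_id.
- have Myx := vn_comp vM My Mx; have Mzx := vn_comp vM Mz Max.
  rewrite JopJ_hat// !hat_dotp// (adj_comp hM)// compA (traceC hM)//.
  exact: (vn_comp vM).
Qed.

(** [|tau z| <= tau |z|], where [a = id - Y] is [|z|].  With the partial
    isometry [w] of the polar decomposition this is the Cauchy-Schwarz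
    inequality for [tau (w a)].  The inverse [D] of [c = a + e] replaces [w],
    the operator [z D] being nearly a partial isometry: one expands
    [0 <= tau (X^* c X)] for [X = D z^* - s], where [s] is a phase such that
    [s * tau z = |tau z|].  As [c D = 1], the expansion is
    [tau (z D z^* ) - 2 |tau z| + tau a + e], and
    [tau (z D z^* ) = tau (a a D) = tau a - e * tau (a D) <= tau a].
    Then [e] tends to 0. *)
Lemma rnorm_trace_le_modulus {z Y} :
  M z -> M Y -> is_adjoint Y Y -> op_bound 1 Y ->
  (id - Y) \o (id - Y) = adj z \o z ->
  rnorm (tau z : R[i]^o) <= complex.Re (tau (id - Y)).
Proof.
move=> Mz MY Ys Y1 YE; set a := id - Y.
have Mi := vn_id vM; have Ma : M a by exact: (vnB vM).
have a_ge0 : positive_op a by exact: positive_sub_contraction.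
have [la _] := vn_bounded vM Ma.
have ta : tau a = (complex.Re (tau a))%:C.
  by rewrite RRe_real// ger0_real// (trace_ge0 hM).
have A0 : 0 <= complex.Re (tau a) by rewrite -ler0c -ta (trace_ge0 hM).
have [t0|t0] := eqVneq (tau z) 0; first by rewrite t0 rnorm0.
pose r := rnorm (tau z : R[i]^o).
have nr : `|tau z| = r%:C by exact: (rnormE (tau z : R[i]^o)).
pose s : R[i] := Num.conj (tau z) / `|tau z|.
have sz : s * tau z = r%:C.
  by rewrite -nr /s mulrAC [Num.conj _ * _]mulrC -normCK expr2 mulfK ?normr_eq0.
have ss : s * Num.conj s = 1.
  rewrite -normCK /s normrM norm_conjC normfV normr_id divff ?expr1n//.
  by rewrite normr_eq0.
rewrite -(ler_pM2l (ltr0n _ 2)); apply/ler_addgt0Pr => e e0.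
have [D MD cD] := vn_resolvent vM _ _ MY Y1 e0.
pose c := e%:C *: id + a.
have Mc : M c by exact: (vn_lin vM).
have [lc _] := vn_bounded vM Mc.
have cDv v : c (D v) = v.
  rewrite -[RHS]cD -[LHS]/(e%:C *: D v + (D v - Y (D v))).
  by rewrite rmorphD scalerDl scale1r addrA [e%:C *: _ + _]addrC.
have as_ : is_adjoint a a.
  move=> u v; change (dotp (u - Y u) v = dotp u (v - Y v)).
  by rewrite dotpBl dotpBr Ys.
have cs : is_adjoint c c.
  move=> u v; change (dotp (e%:C *: u + a u) v = dotp u (e%:C *: v + a v)).
  by rewrite dotpDl dotpDr dotpZl dotpZr conj_Creal ?complex_real// as_.
have Ds : is_adjoint D D.
  by move=> u v; rewrite -{1}(cDv v) -cs cDv.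
have aD : a \o D = (- e%:C) *: D + id.
  apply/funext => v; rewrite -[RHS]/((- e%:C) *: D v + v) -[X in _ + X]cDv.
  by rewrite -[c _]/(e%:C *: D v + a (D v)) scaleNr addKr.
have MaD : M (a \o D) by exact: (vn_comp vM).
have aD_ge0 : positive_op (a \o D).
  move=> v /=; rewrite -{2}(cDv v) -[c _]/(e%:C *: D v + a (D v)).
  rewrite dotpDr dotpZr conj_Creal ?complex_real// addr_ge0//.
  by rewrite mulr_ge0// ?ler0c ?(ltW e0)//; exact: a_ge0.
have tb : tau (a \o D) = (complex.Re (tau (a \o D)))%:C.
  by rewrite RRe_real// ger0_real// (trace_ge0 hM).
have B0 : 0 <= complex.Re (tau (a \o D)) by rewrite -ler0c -tb (trace_ge0 hM).
have Mza := vn_adj vM Mz.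
have MDza : M (D \o adj z) by exact: (vn_comp vM).
pose X := (- s) *: id + (D \o adj z).
have MX : M X by exact: (vn_lin vM).
have cX : c \o X = (- s) *: c + adj z.
  apply/funext => v; change (c (- s *: v + D (adj z v)) = - s *: c v + adj z v).
  by rewrite lc cDv.
have McX : M (c \o X) by exact: (vn_comp vM).
have : 0 <= dotp (hat E (c \o X)) (hat E X).
  rewrite hat_dotp// (trace_ge0 hM)//.
    by apply: (vn_comp vM) => //; exact: (vn_adj vM).
  move=> v; rewrite (tracial_adjPr hM)//; set w := X v.
  change (0 <= dotp (e%:C *: w + a w) w).
  rewrite dotpDl dotpZl addr_ge0 ?mulr_ge0 ?ler0c ?(ltW e0)//.
have c1 : dotp (hat E c) (hat E id) = (e + complex.Re (tau a))%:C.
  by rewrite -traceE// (trace_lin hM)// (trace_id hM) mulr1 ta -rmorphD.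
have cz : dotp (hat E c) (hat E (D \o adj z)) = tau z.
  rewrite dotpC hat_dotp// (adj_eq cs).
  rewrite (_ : c \o (D \o adj z) = adj z); last by apply/funext => v /=.
  by rewrite (trace_adj Mz) conjCK.
have z1 : dotp (hat E (adj z)) (hat E id) = Num.conj (tau z).
  by rewrite -traceE// trace_adj.
have zz : dotp (hat E (adj z)) (hat E (D \o adj z))
    = (complex.Re (tau a) - e * complex.Re (tau (a \o D)))%:C.
  have MzD := vn_comp vM Mz MD.
  rewrite hat_dotp// (adj_comp hM)// (adjK hM)// (adj_eq Ds) (traceC hM)//.
  rewrite compA -YE -compA -/a [in LHS]aD.
  have -> : a \o ((- e%:C) *: D + id) = (- e%:C) *: (a \o D) + a.
    by apply/funext => v; rewrite -[LHS]/(a ((- e%:C) *: D v + v)) la.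
  rewrite (trace_lin hM)// [in LHS]ta [in LHS]tb.
  by rewrite mulNr addrC -rmorphM -rmorphB.
rewrite cX (hat_linear E _ Mc Mza) (hat_linear E _ Mi MDza).
rewrite dotpDl !dotpDr !dotpZl !dotpZr c1 cz z1 zz.
rewrite rmorphN mulrA mulrNN ss mul1r !mulNr sz -(rmorphM (Num.conj)) sz.
rewrite /= (conj_Creal (x := r%:C)) ?complex_real//.
rewrite -!rmorphN -!rmorphD ler0c -/r.
have := mulr_ge0 (ltW e0) B0; lra.
Qed.

(** By density and scaling it is enough to take for [v] a contraction [y] of
    [M].  Then [dotp y u = tau (u^* y)], and [u^* y] has the same absolute value
    as [y], whose trace is the norm of [y] in [L1]. *)
Lemma rnorm_dotp_unitary {u} (v : L2 E) : M u -> unitary u ->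
  rnorm (dotp v (hat E u) : R[i]^o) <= rnorm (Defs.incl E v).
Proof.
move=> Mu [uu uu']; rewrite -subr_ge0.
have Mau := vn_adj vM Mu.
apply: (dense_ge0 _
  (fun v => rnorm (Defs.incl E v) - rnorm (dotp v (hat E u) : R[i]^o))
  (@hat_dense _ _ _ _ E)) => [w|_ [x Mx <-]].
  apply: cvgB.
    by apply: continuous_comp; [exact: incl_continuous|exact: rnorm_continuous].
  apply: (@continuous_comp _ _ _
    (fun v => dotp v (hat E u) : R[i]^o) (@rnorm R R[i]^o)).
    by apply: (@continuous_dotp_comp _ _ id) => w'; exact: cvg_id.
  exact: rnorm_continuous.
have [C C0 xC] := bounded_op_rnorm (vn_bounded vM Mx).
(* C may vanish, 1 + C is invertible *)
pose c := 1 + C; have c0 : 0 < c by rewrite ltr_wpDr.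
pose y := (c^-1)%:C *: x.
have My : M y by exact: (vnZ vM).
have y1 : op_bound 1 y.
  move=> w; rewrite -[y w]/((c^-1)%:C *: x w) rnormZ rnorm_real.
  rewrite gtr0_norm ?invr_gt0//.
  rewrite mul1r ler_pdivrMl// (le_trans (xC w))// ler_wpM2r ?rnorm_ge0//.
  by rewrite lerDr.
have -> : x = c%:C *: y.
  by rewrite scalerA -rmorphM divff ?scale1r// lt0r_neq0.
have adjM T : M T -> is_adjoint T (adj T) by exact: (tracial_adjP hM).
have [Y [MY Ys Y1 YE]] := contraction_modulus vM adjM My y1.
have Ma : M (id - Y) by apply: (vnB vM) => //; exact: (vn_id vM).
rewrite hatZ// (linZ (incl_linear (s := E))) dotpZl !rnormZ -mulrBr.
rewrite mulr_ge0 ?rnorm_ge0// subr_ge0.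
rewrite hat_dotp// {2}/rnorm (incl_norm E My Ma); last first.
  split; [exact: (vn_bounded vM Ma)|exact: positive_sub_contraction|exact: YE].
have Mz := vn_comp vM Mau My.
apply: (rnorm_trace_le_modulus Mz MY Ys Y1).
rewrite YE (adj_comp hM)// (adjK hM)//.
by rewrite -compA (compA u) uu'.
Qed.

End StandardForm.

(** * Limits along ultrafilters *)

Section Ultralimits.
Context {R : realType}.

Lemma ultra_fmap {I T : Type} (f : I -> T) (U : set_system I) :
  UltraFilter U -> UltraFilter (f @ U).
Proof.
move=> UU; split; first exact: fmap_proper_filter.
move=> G PG UG; rewrite eqEsubset; split=> // A GA.
have [//|UA] := in_ultra_setVsetC (f @^-1` A) UU.
have GA' : G (~` A) by exact: UG.
have [x [? ?]] := filter_ex (filterI GA GA'); contradiction.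
Qed.

Lemma real_bounded_ultra_cvg {I : Type} (U : set_system I) (f : I -> R)
    (C : R) :
  UltraFilter U -> (forall i, `|f i| <= C) -> cvg (f @ U).
Proof.
move=> UU fC; have := @segment_compact R (- C) C; rewrite compact_ultra.
move=> /(_ (f @ U) (ultra_fmap f U UU)) [|l [_ fl]]; last first.
  by apply/cvg_ex; exists l.
by apply: nearW => i /=; rewrite in_itv /= -ler_norml.
Qed.

Lemma cvg_complex {I : Type} {F : set_system I} {FF : Filter F}
    (f : I -> R[i]) (a b : R) :
  complex.Re (f i) @[i --> F] --> a -> complex.Im (f i) @[i --> F] --> b ->
  (f i : R[i]^o) @[i --> F] --> (Complex a b : R[i]^o).
Proof.
move=> fa fb.
apply: (@cvg_rnorm_le _ _ _ _ _ _ _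
  (fun i => `|complex.Re (f i) - a| + `|complex.Im (f i) - b|)).
  move=> i; case: (f i) => x y.
  have -> : Complex x y - Complex a b = (x - a)%:C + 'i * (y - b)%:C.
    by simpc.
  rewrite (le_trans (rnormD _ _))//= rnorm_real lerD2l.
  rewrite -[X in rnorm X]/('i *: ((y - b)%:C : R[i]^o)) rnormZ rnorm_real.
  by rewrite /rnorm normc_def /= expr0n add0r expr1n sqrtr1 mul1r.
rewrite -(addr0 0); apply: cvgD; rewrite -(normr0 R).
  by apply: cvg_norm; rewrite -(subrr a); apply: cvgB => //; exact: cvg_cst.
by apply: cvg_norm; rewrite -(subrr b); apply: cvgB => //; exact: cvg_cst.
Qed.

Lemma bounded_ultra_cvg {I : Type} (U : set_system I) (f : I -> R[i]) (C : R) :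
  UltraFilter U -> (forall i, rnorm (f i : R[i]^o) <= C) ->
  cvg ((f : I -> R[i]^o) @ U).
Proof.
move=> UU fC.
have reC i : `|complex.Re (f i)| <= C.
  by rewrite (le_trans _ (fC i))// -lecR -(rnormE (f i : R[i]^o)) normc_ge_Re.
have imC i : `|complex.Im (f i)| <= C.
  rewrite (le_trans _ (fC i))// -lecR -(rnormE (f i : R[i]^o)) normc_def lecR.
  by rewrite -sqrtr_sqr ler_wsqrtr// lerDr sqr_ge0.
have /cvg_ex[a fa] := real_bounded_ultra_cvg U _ _ UU reC.
have /cvg_ex[b fb] := real_bounded_ultra_cvg U _ _ UU imC.
by apply/cvg_ex; exists (Complex a b); exact: cvg_complex.
Qed.

Lemma cvg_Re {I : Type} {F : set_system I} {FF : Filter F}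
    (f : I -> R[i]) (l : R[i]) :
  (f i : R[i]^o) @[i --> F] --> (l : R[i]^o) ->
  complex.Re (f i) @[i --> F] --> complex.Re l.
Proof.
move=> /cvg_rnormP fl; apply/cvgrPdist_le => e e0.
move/cvgrPdist_le : fl => /(_ e e0); apply: filterS => i.
rewrite sub0r normrN ger0_norm ?rnorm_ge0//; apply: le_trans.
rewrite distrC -raddfB -lecR -(rnormE (_ : R[i]^o)); exact: normc_ge_Re.
Qed.

Lemma cvg_complex_ge0 {I : Type} {F : set_system I} {FF : ProperFilter F}
    (f : I -> R[i]) (l : R[i]) :
  (forall i, 0 <= f i) -> (f i : R[i]^o) @[i --> F] --> (l : R[i]^o) -> 0 <= l.
Proof.
move=> f0 fl.
have fE : f = fun i => (complex.Re (f i))%:C.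
  by apply/funext => i; rewrite RRe_real// ger0_real.
have re : complex.Re (f i) @[i --> F] --> complex.Re l by exact: cvg_Re.
have l0 : 0 <= complex.Re l.
  apply: (cvgr_to_ge re); apply: nearW => i.
  by rewrite -ler0c -[X in 0 <= X](congr1 (@^~ i) fE).
rewrite fE in fl.
have -> : l = (complex.Re l)%:C.
  apply: (@norm_cvg_unique _ R[i]^o _ _ _ _ fl).
  by apply: cvg_complex => //=; exact: cvg_cst.
by rewrite ler0c.
Qed.

End Ultralimits.

(** * The norm from M to L1 *)

Section OperatorNorm.
Context {R : realType} {V : hilbertType R}.
Implicit Types T : V -> V.

Lemma op_boundP {T} : bounded_op T -> op_bound (op_norm T) T.
Proof.
move=> bT v; have [C C0 TC] := bounded_op_rnorm bT; have [lT _] := bT.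
have [->|v0] := eqVneq v 0; first by rewrite (lin0 lT) !rnorm0 mulr0.
have nv : 0 < rnorm v.
  rewrite lt_neqAle rnorm_ge0 andbT eq_sym.
  by apply: contra_neq v0 => /rnorm_eq0.
rewrite -ler_pdivrMr//; apply: ub_le_sup.
  exists C => _ [w /= w1 <-]; rewrite (le_trans (TC w))//.
  by rewrite -[leRHS]mulr1 ler_wpM2l.
have nn : rnorm ((rnorm v)^-1%:C : R[i]^o) = (rnorm v)^-1.
  by rewrite rnorm_real gtr0_norm ?invr_gt0.
exists ((rnorm v)^-1%:C *: v) => /=.
  by rewrite rnormZ nn mulVf// lt0r_neq0.
by rewrite (linZ lT) rnormZ nn mulrC.
Qed.

Lemma op_norm_le1 {T} : op_bound 1 T -> op_norm T <= 1.
Proof.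
move=> T1; apply: ge_sup => [|_ [w /= w1 <-]].
  by exists (rnorm (T 0)), 0 => //=; rewrite rnorm0.
by rewrite (le_trans (T1 w))// mul1r.
Qed.

End OperatorNorm.

Section StandardFormEstimates.
Context {R : realType} {H : hilbertType R}.
Context {M : set (H -> H)} {tau : (H -> H) -> R[i]}.
Hypothesis hM : tracial_von_neumann_algebra M tau.
Variable E : standard_form M tau.
Implicit Types x y z u : H -> H.
Let vM := tracial_vn hM.

Lemma unitary_contraction {u} : M u -> unitary u -> op_bound 1 u.
Proof.
move=> Mu [uu _] v; rewrite mul1r -ler_sqr ?nnegrE ?rnorm_ge0//.
by rewrite -!Re_dotp (tracial_adjP hM Mu) -[adj u (u v)]/((adj u \o u) v) uu.
Qed.

(** The operator [1 - x^*x] is positive, so [tau (x^*x) <= tau 1 = 1]. *)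
Lemma rnorm_hat_contraction {x} : M x -> op_bound 1 x -> rnorm (hat E x) <= 1.
Proof.
move=> Mx x1; have Max := vn_adj vM Mx; have Mi := vn_id vM.
have Mxx := vn_comp vM Max Mx.
have Md : M (id - (adj x \o x)) by exact: (vnB vM).
rewrite -(@ler_sqr _ (rnorm (hat E x))) ?nnegrE ?rnorm_ge0//.
rewrite expr1n -Re_dotp hat_dotp//.
have : 0 <= tau (id - (adj x \o x)).
  apply: (trace_ge0 hM) => // v.
  change (0 <= dotp (v - adj x (x v)) v).
  rewrite dotpBl (tracial_adjPr hM)// !dotp_rnorm -rmorphB ler0c subr_ge0.
  by rewrite ler_sqr ?nnegrE ?rnorm_ge0// (le_trans (x1 v))// mul1r.
rewrite addrC -scaleN1r (trace_lin hM)// mulN1r (trace_id hM).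
rewrite lecE => /andP[_] /=; case: (tau (adj x \o x)) => a b /=; lra.
Qed.

(** The supremum defining [norm_infty_1 T] is an upper bound because it is taken
    over a bounded set: [T], the inclusion of [L2] in [L1] and [hat] on the unit
    ball are bounded. *)
Lemma rnorm_incl_le_norm_infty_1 {T : L2 E -> L2 E} {u} :
  bounded_op T -> M u -> unitary u ->
  rnorm (Defs.incl E (T (hat E u))) <= norm_infty_1 T.
Proof.
move=> bT Mu uu; apply: ub_le_sup; last first.
  by exists u => //; split=> //; exact/op_norm_le1/unitary_contraction.
have [C C0 TC] := bounded_op_rnorm bT.
have [B B0 iB] := continuous_linear_rnorm (incl_linear (s := E))
  (@incl_continuous _ _ _ _ E).
exists (B * C) => _ [x [Mx x1] <-].
rewrite (le_trans (iB _))// ler_wpM2l// (le_trans (TC _))//.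
rewrite -[leRHS]mulr1 ler_wpM2l// rnorm_hat_contraction// => v.
by rewrite (le_trans (op_boundP (vn_bounded vM Mx) v))// ler_wpM2r ?rnorm_ge0.
Qed.

End StandardFormEstimates.

(** * Unitaries tending ultraweakly to zero *)

Lemma tails_proper {I : Type} (le : I -> I -> Prop) :
  directed le -> ProperFilter (tails le).
Proof.
move=> [[i0] refl trans dir]; apply: Build_ProperFilter_ex.
  by move=> P [i iP]; exists i; exact: iP.
split; first by exists i0.
  move=> P Q [i iP] [j jQ]; have [k [ik jk]] := dir i j.
  by exists k => l kl; split; [apply: iP|apply: jQ]; apply: trans kl.
by move=> P Q PQ [i iP]; exists i => j ij; exact/PQ/iP.
Qed.

Section Gamma.
Context {R : realType} {H : hilbertType R}.
Context {M : set (H -> H)} {tau : (H -> H) -> R[i]}.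
Hypothesis hM : tracial_von_neumann_algebra M tau.
Variable E : standard_form M tau.
Context {I : Type} {F : set_system I} {PF : ProperFilter F}.
Variable u : I -> H -> H.
Hypothesis Mu : forall i, M (u i).
Hypothesis uu : forall i, unitary (u i).
Hypothesis u0 : ultraweak_cvg (u @ F) 0.
Let vM := tracial_vn hM.

(** Left multiplication by [x^*] is ultraweakly continuous: in the pairing with
    square summable sequences it moves to the second one as [x]. *)
Lemma uw_adj_comp {x} : M x -> ultraweak_cvg ((fun i => adj x \o u i) @ F) 0.
Proof.
move=> Mx xi eta sxi seta.
have [C C0 xC] := bounded_op_rnorm (vn_bounded vM Mx).
have sxeta : square_summable (x \o eta).
  apply: (@series_le_cvg _ _ (C ^+ 2 *: (fun k => rnorm (eta k) ^+ 2))).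
  - by move=> n; rewrite exprn_ge0// rnorm_ge0.
  - by move=> n; apply: mulr_ge0; rewrite ?exprn_ge0 ?rnorm_ge0.
  - move=> n; change (rnorm (x (eta n)) ^+ 2 <= C ^+ 2 * rnorm (eta n) ^+ 2).
    by rewrite -exprMn ler_sqr ?nnegrE ?mulr_ge0 ?rnorm_ge0.
  - exact: is_cvg_seriesZ.
have E0 : uw_pairing xi eta 0 = uw_pairing xi (x \o eta) 0.
  by congr (limn (series _)); apply/funext => k /=; rewrite !dotp0l.
rewrite E0.
have uwE : (fun i => uw_pairing xi eta (adj x \o u i)) =
    (fun i => uw_pairing xi (x \o eta) (u i)).
  apply/funext => i; congr (limn (series _)); apply/funext => k /=.
  by rewrite (tracial_adjPr hM).
change (uw_pairing xi eta (adj x \o u i) @[i --> F]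
  --> uw_pairing xi (x \o eta) 0).
by rewrite uwE; exact: u0.
Qed.

(** Against [hat E x] the coefficient is [tau (x^* u)], which tends to 0 by
    normality of the trace; as the vectors [hat E (u i)] are bounded, density
    gives the rest. *)
Lemma hat_weak0 (v : L2 E) :
  (dotp (hat E (u i)) v : R[i]^o) @[i --> F] --> (0 : R[i]^o).
Proof.
have hx x : M x ->
    (dotp (hat E (u i)) (hat E x) : R[i]^o) @[i --> F] --> (0 : R[i]^o).
  move=> Mx; rewrite -(trace0 hM).
  rewrite (_ : (fun i => _) = (fun i => tau (adj x \o u i))); last first.
    by apply/funext => i; rewrite hat_dotp.
  have [_ _ tn _ _] := hM; apply: (tn ((fun i => adj x \o u i) @ F)).
  - by apply: nearW => i; apply: (vn_comp vM) => //; exact: (vn_adj vM).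
  - exact: (vn0 vM).
  - exact: uw_adj_comp.
apply/cvg_rnormP/cvgrPdist_lt => e e0.
have e2 : 0 < e / 2 by rewrite divr_gt0.
have [_ [x Mx <-] vx] := dense_approx _ v _ (@hat_dense _ _ _ _ E) e2.
have /cvg_rnormP/cvgrPdist_lt/(_ _ e2) := hx x Mx; apply: filterS => i.
rewrite !subr0 !sub0r !normrN !ger0_norm ?rnorm_ge0// => h.
rewrite -[dotp _ v](subrK (dotp (hat E (u i)) (hat E x))) -dotpBr.
rewrite (le_lt_trans (rnormD _ _))// (splitr e) ltrD//.
by rewrite (le_lt_trans (cauchy_schwarz _ _))// (rnorm_hat_unitary hM)// mul1r.
Qed.

(** Along an ultrafilter the images [K (hat E (u i))] converge in norm to some
    [w], and [hat E (u i)] tends weakly to 0. *)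
Lemma compact_diag_cvg0 (UF : UltraFilter F) (K : L2 E -> L2 E) :
  compact_op K ->
  (dotp (K (hat E (u i))) (hat E (u i)) : R[i]^o) @[i --> F] --> (0 : R[i]^o).
Proof.
move=> [_ cK].
have Ku i : closure (K @` [set v | rnorm v <= 1]) (K (hat E (u i))).
  apply: subset_closure; exists (hat E (u i)) => //=.
  by rewrite (rnorm_hat_unitary hM).
move: cK; rewrite compact_ultra.
move=> /(_ _ (ultra_fmap (fun i => K (hat E (u i))) F UF)) [|w [_ Kw]].
  exact: nearW.
move/cvg_rnormP : Kw => Kw.
pose g i := rnorm (K (hat E (u i)) - w) + rnorm (dotp (hat E (u i)) w : R[i]^o).
apply: (@cvg_rnorm_le _ _ _ _ _ _ _ g).
  move=> i; rewrite subr0 -[K _](subrK w) dotpDl (le_trans (rnormD _ _))//.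
  rewrite lerD//.
    by rewrite (le_trans (cauchy_schwarz _ _))// (rnorm_hat_unitary hM)// mulr1.
  by rewrite (dotpC w) /rnorm norm_conjC.
rewrite -(addr0 0); apply: cvgD => //.
by have /cvg_rnormP := hat_weak0 w; under eq_fun do rewrite subr0.
Qed.

(** Split [T] into a compact [K] and an error which is small from [M] to [L1];
    the coefficient of the error at the unitary [u i] is at most its norm. *)
Lemma K_infty_1_diag_cvg0 (UF : UltraFilter F) (T : L2 E -> L2 E) :
  K_infty_1 T ->
  (dotp (T (hat E (u i))) (hat E (u i)) : R[i]^o) @[i --> F] --> (0 : R[i]^o).
Proof.
move=> [bT TK]; apply/cvg_rnormP/cvgrPdist_lt => e e0.
have e2 : 0 < e / 2 by rewrite divr_gt0.
have [K cK TKe] := TK _ e2.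
have bTK : bounded_op (T - K).
  by rewrite addrC -scaleN1r; apply: bounded_op_lin => //; case: cK.
have /cvg_rnormP/cvgrPdist_lt/(_ _ e2) := compact_diag_cvg0 UF K cK.
apply: filterS => i.
rewrite !subr0 !sub0r !normrN !ger0_norm ?rnorm_ge0// => h.
rewrite -[T _](subrK (K (hat E (u i)))) dotpDl.
rewrite (le_lt_trans (rnormD _ _))// (splitr e) ler_ltD//.
rewrite (le_trans (rnorm_dotp_unitary hM E _ (Mu i) (uu i)))//.
rewrite (le_trans _ (ltW TKe))//.
exact: (rnorm_incl_le_norm_infty_1 hM E bTK (Mu i) (uu i)).
Qed.

End Gamma.

(** * The central state *)

Section VectorStates.
Context {R : realType} {H : hilbertType R}.
Context {M : set (H -> H)} {tau : (H -> H) -> R[i]}.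
Hypothesis hM : tracial_von_neumann_algebra M tau.
Variable E : standard_form M tau.
Context {I : Type} {F : set_system I} {UF : UltraFilter F}.
Variable u : I -> H -> H.
Hypothesis Mu : forall i, M (u i).
Hypothesis uu : forall i, unitary (u i).
Hypothesis u0 : ultraweak_cvg (u @ F) 0.
Hypothesis uc : forall x, M x ->
  norm2 tau (commutator x (u i)) @[i --> F] --> (0 : R).
Let vM := tracial_vn hM.

Definition vector_state_limit (T : L2 E -> L2 E) : R[i] :=
  lim ((dotp (T (hat E (u i))) (hat E (u i)) : R[i]^o) @[i --> F]).

Lemma vector_state_cvg {T : L2 E -> L2 E} : bounded_op T ->
  (dotp (T (hat E (u i))) (hat E (u i)) : R[i]^o) @[i --> F]
    --> (vector_state_limit T : R[i]^o).
Proof.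
move=> bT; have [C C0 TC] := bounded_op_rnorm bT.
apply: (bounded_ultra_cvg F _ C UF) => i.
rewrite (le_trans (cauchy_schwarz _ _))// (le_trans _ (_ : C * 1 * 1 <= C))//.
  by have := TC (hat E (u i)); rewrite (rnorm_hat_unitary hM)// !mulr1.
by rewrite !mulr1.
Qed.

Lemma vector_state_eq {T : L2 E -> L2 E} {l : R[i]} : bounded_op T ->
  (dotp (T (hat E (u i))) (hat E (u i)) : R[i]^o) @[i --> F] --> (l : R[i]^o) ->
  vector_state_limit T = l.
Proof.
by move=> bT; apply: (@norm_cvg_unique _ R[i]^o); exact: vector_state_cvg.
Qed.

Lemma vector_state_limit_state : state_on (@SS _ _ _ _ E) vector_state_limit.
Proof.
split.
- move=> a S T [bS _] [bT _].
  apply: vector_state_eq; first exact: bounded_op_lin.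
  rewrite (_ : (fun i => _) = fun i =>
      a * dotp (S (hat E (u i))) (hat E (u i))
      + dotp (T (hat E (u i))) (hat E (u i))).
    apply: (@cvgD _ R[i]^o); last exact: vector_state_cvg.
    by apply: (@cvgZr _ R[i]^o); exact: vector_state_cvg.
  by apply/funext => i; rewrite -dotpZl -dotpDl.
- move=> T [bT _] T0.
  apply: (cvg_complex_ge0 (F := F) _ _ _ (vector_state_cvg bT)).
  by move=> i; exact: T0.
- apply: vector_state_eq; first exact: bounded_op_id.
  apply: cvg_near_cst; apply: nearW => i.
  by rewrite dotp_rnorm (rnorm_hat_unitary hM)// expr1n.
Qed.

Lemma vector_state_trace {x} : M x -> vector_state_limit (lmul E x) = tau x.
Proof.
move=> Mx; apply: vector_state_eq; first exact: lmul_bounded.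
apply: cvg_near_cst; apply: nearW => i.
have Mxu := vn_comp vM Mx (Mu i); have Mua := vn_adj vM (Mu i).
rewrite lmul_hat// hat_dotp// (traceC hM)// -compA.
by have [_ ->] := uu i.
Qed.

Lemma vector_state_normal : normal_on M (vector_state_limit \o lmul E).
Proof.
move=> G T PG GM MT GT /=; rewrite vector_state_trace//.
have [_ _ tn _ _] := hM; apply: cvg_trans (tn G T PG GM MT GT).
by apply: near_eq_cvg; apply: filterS GM => x Mx /=; rewrite vector_state_trace.
Qed.

(** Write [h] for [hat E (u i)].  Then [dotp (x T h) h] is
    [dotp (T h) (hat (x^* u))], while [dotp (T x h) h] is
    [dotp (T (hat (x u))) h].  Replacing [x^* u] by [u x^*] and [x u] by [u x]
    costs the error [err], and turns the difference into a coefficient of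
    [[T, J x^* J]], up to sign. *)
Lemma vector_state_central : central_on_SS vector_state_limit.
Proof.
move=> x T Mx [bT TK]; have [lT _] := bT.
have Max := vn_adj vM Mx; have blx := lmul_bounded E Mx.
apply: vector_state_eq; first exact: bounded_op_comp.
have /vector_state_cvg cB : bounded_op (T \o lmul E x).
  exact: bounded_op_comp.
pose h i := hat E (u i).
have h1 i : rnorm (h i) = 1 by rewrite (rnorm_hat_unitary hM).
have cK : (dotp (commutator T (JopJ (adj x)) (h i)) (h i) : R[i]^o) @[i --> F]
    --> (0 : R[i]^o).
  exact: (K_infty_1_diag_cvg0 hM E u Mu uu u0 UF _ (TK _ Max)).
pose d y i := rnorm (hat E (commutator y (u i))).
have d0 y : M y -> d y i @[i --> F] --> (0 : R).
  move=> My; rewrite (_ : d y = fun i => norm2 tau (commutator y (u i))).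
    exact: uc.
  apply/funext => i; apply: rnorm_hat.
  by apply: (vnB vM); apply: (vn_comp vM).
have [C C0 TC] := bounded_op_rnorm bT.
pose err i : R[i] := dotp (T (h i)) (hat E (commutator (adj x) (u i)))
   - dotp (T (hat E (commutator x (u i)))) (h i).
have err0 : (err i : R[i]^o) @[i --> F] --> (0 : R[i]^o).
  apply: (@cvg_rnorm_le _ _ _ _ _ _ _ (fun i => C * d (adj x) i + C * d x i)).
    move=> i; rewrite subr0 (le_trans (rnormD _ _))// rnormN lerD//.
      rewrite (le_trans (cauchy_schwarz _ _))// ler_wpM2r ?rnorm_ge0//.
      by rewrite (le_trans (TC _))// h1 mulr1.
    by rewrite (le_trans (cauchy_schwarz _ _))// h1 mulr1 TC.
  rewrite -[X in _ --> X](addr0 (0 : R)) -{1 2}(mulr0 C).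
  by apply: cvgD; apply: cvgMr; exact: d0.
rewrite -[X in _ --> X]addr0 -[X in _ --> X + _]subr0.
rewrite (_ : (fun i => _) = fun i => dotp ((T \o lmul E x) (h i)) (h i)
    - dotp (commutator T (JopJ (adj x)) (h i)) (h i) + err i).
  apply: (@cvgD _ R[i]^o); last exact: err0.
  by apply: (@cvgB _ R[i]^o); [exact: cB|exact: cK].
apply/funext => i; have Mui := Mu i.
have [Mxu Mux] := (vn_comp vM Mx Mui, vn_comp vM Mui Mx).
have [Myu Muy] := (vn_comp vM Max Mui, vn_comp vM Mui Max).
rewrite /err /h /commutator !hatB//= (linB lT) !dotpBl dotpBr.
rewrite /= lmul_hat// (JopJ_hat hM)// (adjK hM)// (lmul_adj hM)//.
rewrite (JopJ_adj hM)//.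
ring.
Qed.

End VectorStates.

Theorem corollary6p9 (R : realType) (H : hilbertType R)
    (M : set (H -> H)) (tau : (H -> H) -> R[i])
    (hM : tracial_von_neumann_algebra M tau)
    (E : standard_form M tau)
    (hGamma : property_Gamma M tau) :
  ~ properly_proximal E.
Proof.
case: hGamma => I [le [u [dir Muu u0 uc]]] pp; apply: pp.
have PT := tails_proper _ dir.
have [F [UF tF]] := ultraFilterLemma PT.
have Mu i : M (u i) by have [] := Muu i.
have uu i : unitary (u i) by have [] := Muu i.
have u0F : ultraweak_cvg (u @ F) 0.
  move=> xi eta sxi seta; apply: cvg_trans (u0 xi eta sxi seta).
  by move=> A; exact: tF.
have ucF x : M x -> norm2 tau (commutator x (u i)) @[i --> F] --> (0 : R).
  move=> Mx; apply: cvg_trans (uc x Mx).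
  by move=> A; exact: tF.
exists (@vector_state_limit _ _ _ _ E _ F u); split.
- exact: vector_state_limit_state.
- exact: vector_state_central.
- exact: vector_state_normal.
Qed.
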